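(* Let $n$ be a positive even integer and let $G=\langle A,\beta\mid \beta^2=\alpha,\ \beta a\beta^{-1}=f(a)\ \text{for all } a\in A\rangle$ be a finite non-abelian group of order $2n$, where $A$ is an abelian subgroup of index $2$, $\alpha\in A$, and $f$ is an automorphism of $A$ of order $2$ with $f(\alpha)=\alpha$. Let $X\subseteq A\setminus\{e\}$ satisfy: (i) $B=A\setminus(X\cup f(X))$ is a subgroup of $A$ with $\alpha\in B$; (ii) $X$ is a union of cosets of $B$; (iii) $X\cap f(X)=aB$ and $X\cup aX=A$ for some $a\in A$. Then $\Gamma=\mathrm{Cay}(G,X\cup X\beta)$ is a DSRG with parameters $(2n,n,\frac{n}{2}+\ell,\frac{n}{2}-\ell,\frac{n}{2}+\ell)$, where $\ell=|B|$.
   Context: $e$ denotes the identity. For a finite group $H$ and $S\subseteq H\setminus\{e\}$, $\mathrm{Cay}(H,S)$ is the directed graph with vertex set $H$ and an arc from $x$ to $y$ iff $yx^{-1}\in S$. $X\beta=\{x\beta:x\in X\}$, $f(X)=\{f(x):x\in X\}$, $aX=\{ax:x\in X\}$, $aB=\{ab:b\in B\}$. A DSRG with parameters $(N,k,\mu,\lambda,t)$ is a $k$-regular loopless directed graph on $N$ vertices such that every vertex $x$ has exactly $t$ vertices $z$ with $x\to z$ and $z\to x$, and for vertices $x\ne y$ the number of $z$ with $x\to z\to y$ is $\lambda$ if $x\to y$ and $\mu$ otherwise. *)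

(* Defs.v *)
From mathcomp Require Import all_boot all_fingroup.

Set Implicit Arguments.
Unset Strict Implicit.
Unset Printing Implicit Defensive.

Local Open Scope group_scope.

(* Only the restriction of [arc] to [vertices] is meaningful. *)
Record digraph (T : finType) := Digraph {
  vertices : {set T};
  arc : rel T
}.

Definition Cay (gT : finGroupType) (H S : {set gT}) : digraph gT :=
  Digraph H [rel x y | y * x^-1 \in S].

(* The parameters are listed in the order (N, k, mu, lambda, t). *)
Definition is_DSRG (T : finType) (D : digraph T) (N k mu lam t : nat) : Prop :=
  [/\ #|vertices D| = N,
      {in vertices D, forall x, ~~ arc D x x},
      {in vertices D, forall x,
        #|[set z in vertices D | arc D x z]| = k /\
        #|[set z in vertices D | arc D z x]| = k},
      {in vertices D, forall x,
        #|[set z in vertices D | arc D x z && arc D z x]| = t} &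
      {in vertices D &, forall x y, x != y ->
        #|[set z in vertices D | arc D x z && arc D z y]|
          = if arc D x y then lam else mu}].

Definition union_of_cosets (gT : finGroupType) (A B X : {set gT}) : Prop :=
  exists2 P : {set {set gT}}, P \subset lcosets B A & X = cover P.

(* Main.v *)
Require Import Defs.
From mathcomp Require Import all_boot all_fingroup.
From mathcomp Require Import zify.

Local Open Scope group_scope.

(** In the integral group ring of G, identify a set with the sum of its
    elements and put S = X + X beta.  As beta x = f(x) beta and X alpha = X,
      S^2 = X (X + f(X)) (1 + beta).
    Here X + f(X) = A - B + aB; counting gives |X| = n/2, so X and aX, which
    cover A, are disjoint and A = X + aX.  As moreover X B = |B| X,
      X (X + f(X)) = n/2 A - |B| X + |B| aX = (n/2 + |B|) A - 2 |B| X,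
    whence S^2 = (n/2 + |B|) G - 2 |B| S, which encodes all the parameters. *)

(* [lia] compares atoms syntactically, but the finType of a cardinal may be
   reached through different canonical paths. *)
Ltac card_lia :=
  repeat match goal with |- context [@card.body ?T ?P] =>
    match goal with |- context [@card.body ?U ?Q] =>
      assert_fails (constr_eq P Q); change (@card.body U Q) with (@card.body T P)
    end
  end; clear; lia.

Lemma union_of_cosets_mulr (gT : finGroupType) (A B : {group gT})
    (X : {set gT}) x b :
  union_of_cosets A B X -> b \in B -> (x * b \in X) = (x \in X).
Proof.
move=> [P sPL ->] bB; apply/bigcupP/bigcupP => [] [C CP].
  have /imsetP[y _ defC] := subsetP sPL _ CP => xC.
  exists C => //; move: xC; rewrite {}defC !lcosetE !mem_lcoset mulgA.
  by rewrite (groupMr _ bB).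
have /imsetP[y _ defC] := subsetP sPL _ CP => xC.
exists C => //; move: xC; rewrite {}defC !lcosetE !mem_lcoset mulgA.
by rewrite (groupMr _ bB).
Qed.

(** Substituting [s = z * x^-1] makes the number of 2-paths the coefficient of [y * x^-1] in S^2;
    the case [y = x] gives t. *)
Lemma card_Cay_between (gT : finGroupType) (G : {group gT}) (S : {set gT}) x y :
    S \subset G -> x \in G ->
  #|[set z in vertices (Cay G S) | Defs.arc (Cay G S) x z && Defs.arc (Cay G S) z y]|
    = #|[set s in S | y * x^-1 * s^-1 \in S]|.
Proof.
move=> sSG Gx; rewrite -[RHS](card_rcoset _ x); apply: eq_card => z.
rewrite mem_rcoset !inE /= invMg invgK mulgA mulgKV.
apply: andb_idl => /andP[/(subsetP sSG) Gzx _].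
by rewrite -(groupMr _ (groupVr Gx)).
Qed.

Lemma card_Cay_out (gT : finGroupType) (G : {group gT}) (S : {set gT}) x :
    S \subset G -> x \in G ->
  #|[set z in vertices (Cay G S) | Defs.arc (Cay G S) x z]| = #|S|.
Proof.
move=> sSG Gx; rewrite -[RHS](card_rcoset _ x); apply: eq_card => z.
rewrite mem_rcoset !inE /=; apply: andb_idl => /(subsetP sSG).
by rewrite groupMr ?groupV.
Qed.

Lemma card_Cay_in (gT : finGroupType) (G : {group gT}) (S : {set gT}) x :
    S \subset G -> x \in G ->
  #|[set z in vertices (Cay G S) | Defs.arc (Cay G S) z x]| = #|S|.
Proof.
move=> sSG Gx; rewrite -[RHS]card_invg -[RHS](card_rcoset _ x); apply: eq_card => z.
rewrite mem_rcoset !inE /= invMg invgK; apply: andb_idl => /(subsetP sSG).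
by rewrite groupMl ?groupV.
Qed.

Section QuotientCount.

Variables (gT : finGroupType) (A B : {group gT}) (f : {perm gT}).
Variables (X : {set gT}) (a : gT).
Hypotheses (abA : abelian A) (fA : f \in Aut A).
Hypothesis sXA : X \subset A.
Hypothesis defB : B :=: A :\: (X :|: f @: X).
Hypothesis XcosB : union_of_cosets A B X.
Hypothesis aA : a \in A.
Hypotheses (XIfX : X :&: f @: X = a *: B) (XUaX : X :|: a *: X = A).

Let sfXA : f @: X \subset A.
Proof.
apply/subsetP=> _ /imsetP[x /(subsetP sXA) Ax ->].
by rewrite Aut_closed.
Qed.

Let sBA : B \subset A. Proof. by rewrite defB subsetDl. Qed.

(** Inclusion-exclusion: 2|X| = |X ∪ f(X)| + |aB| = (|A| - |B|) + |B|. *)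
Lemma card_double_half : #|A| = (2 * #|X|)%N.
Proof.
have := cardsUI X (f @: X); rewrite XIfX card_lcoset (card_imset _ (@perm_inj _ f)).
have := cardsD A (X :|: f @: X); rewrite -defB.
have sU : X :|: f @: X \subset A by rewrite subUset sXA.
rewrite (setIidPr sU); have := subset_leq_card sU; card_lia.
Qed.

(** X and aX cover A and their sizes sum to |A|, so they are disjoint. *)
Lemma half_lcoset_compl g : g \in A -> (g \in a *: X) = (g \notin X).
Proof.
have XI0 : X :&: a *: X = set0.
  apply/eqP; rewrite -cards_eq0; apply/eqP; move: (cardsUI X (a *: X)).
  by move: card_double_half; rewrite XUaX card_lcoset; card_lia.
rewrite -XUaX inE; have := in_set0 g; rewrite -XI0 inE.
by case: (g \in X) => //= ->.
Qed.

(** This is the coefficient of g in X (X + f(X)) = (|X| + |B|) A - 2 |B| X, with the negative term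
    moved across to stay in the naturals. *)
Lemma card_factorizations g : g \in A ->
  (#|[set x in X | (g * x^-1)%g \in X]| + #|[set x in f @: X | (g * x^-1)%g \in X]|
     + 2 * #|B| * (g \in X) = #|X| + #|B|)%N.
Proof.
move=> Ag; pose T := [set y in A | g * y^-1 \in X].
have eqT (Y : {set gT}) : Y \subset A ->
  [set x in Y | g * x^-1 \in X] = Y :&: T.
  move=> sYA; apply/setP=> y; rewrite !inE.
  by apply: andb_id2l => /(subsetP sYA) ->.
(* The union of X and f(X) is A minus B and their intersection is aB, so the sum becomes |T| - |B ∩
   T| + |aB ∩ T|. *)
rewrite !eqT // -cardsUI -setIUl.
have -> : X :&: T :&: (f @: X :&: T) = a *: B :&: T.
  by rewrite -XIfX setIACA setIid.
have cT : #|T| = #|X|.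
  rewrite -card_invg -(card_lcoset X g^-1); apply: eq_card => y.
  rewrite mem_lcoset !inE !invgK groupV; apply: andb_idl => /(subsetP sXA).
  by rewrite groupMl.
(* X absorbs factors from B, so B lies in T or misses it. *)
have cBT : #|B :&: T| = (#|B| * (g \in X))%N.
  transitivity #|if g \in X then gval B else set0|; last first.
    by case: ifP; rewrite ?cards0 ?muln1 ?muln0.
  apply: eq_card => y; transitivity ((y \in B) && (g \in X)); last first.
    by case: ifP; rewrite ?in_set0 ?andbT ?andbF.
  rewrite !inE; apply: andb_id2l => By; rewrite (subsetP sBA) //=.
  by rewrite (union_of_cosets_mulr _ _ _ _ _ _ XcosB) ?groupV.
(* For y = ab, [g * y^-1] is in X iff [a^-1 * g] is, that is, iff g lies in aX, the complement of
   X. *)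
have caBT : #|a *: B :&: T| = (#|B| * (g \notin X))%N.
  transitivity #|if g \notin X then a *: B else set0|; last first.
    by case: ifP; rewrite ?cards0 ?card_lcoset ?muln1 ?muln0.
  apply: eq_card => y.
  transitivity ((y \in a *: B) && (g \notin X)); last first.
    by case: ifP; rewrite ?in_set0 ?andbT ?andbF.
  rewrite !inE -half_lcoset_compl //; apply: andb_id2l => /lcosetP[b Bb ->].
  have Ab := subsetP sBA b Bb; rewrite groupM //= mem_lcoset.
  rewrite -(union_of_cosets_mulr _ _ _ _ (a^-1 * g) b^-1 XcosB) ?groupV //.
  congr (_ \in X); rewrite invMg (centsP abA b^-1 _ a^-1) ?groupV //.
  by rewrite mulgA (centsP abA g _ a^-1) ?groupV.
have cUT : (#|(X :|: f @: X) :&: T| + #|B :&: T| = #|T|)%N.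
  rewrite -(cardsID (X :|: f @: X) T) setIC; congr (_ + _)%N.
  rewrite defB; apply: eq_card => y; rewrite !inE; case: (y \in A).
    by rewrite !andbT.
  by rewrite !andbF.
by move: cUT; rewrite caBT cBT cT; case: (g \in X) => /=; lia.
Qed.

End QuotientCount.

Theorem theorem6 (gT : finGroupType) (n : nat) (G A B : {group gT})
    (alpha beta : gT) (f : {perm gT}) (X : {set gT})
    (n_gt0 : (0 < n)%N) (n_even : ~~ odd n)
    (cardG : #|G| = (2 * n)%N) (nonabG : ~~ abelian G)
    (sAG : A \subset G) (abA : abelian A) (indexA : #|G : A| = 2)
    (alphaA : alpha \in A)
    (fA : f \in Aut A) (order_f : #[f] = 2) (f_alpha : f alpha = alpha)
    (genG : G :=: <<beta |: A>>)
    (beta2 : beta ^+ 2 = alpha)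
    (beta_conj : forall a, a \in A -> beta * a * beta^-1 = f a)
    (sXA : X \subset A :\ 1)
    (defB : B :=: A :\: (X :|: f @: X)) (alphaB : alpha \in B)
    (XcosB : union_of_cosets A B X)
    (hX : exists2 a, a \in A & X :&: f @: X = a *: B /\ X :|: a *: X = A) :
  is_DSRG (Cay G (X :|: X :* beta))
    (2 * n)%N n (n./2 + #|B|)%N (n./2 - #|B|)%N (n./2 + #|B|)%N.
Proof.
case: hX => a aA [XIfX XUaX].
have [{}sXA X1] : X \subset A /\ 1 \notin X by apply/andP; rewrite -subsetD1.
have cardA : #|A| = n.
  by have := Lagrange sAG; rewrite indexA cardG; lia.
have cX : n = (2 * #|X|)%N.
  by rewrite -cardA; exact: (card_double_half _ _ _ _ _ _ fA sXA defB XIfX).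
have cX2 : n./2 = #|X| by lia.
have fK x : f (f x) = x.
  by rewrite -permM -expg2 -order_f expg_order perm1.
have Af x : x \in A -> f x \in A by move=> Ax; rewrite Aut_closed.
have fV x : x \in A -> f x^-1 = (f x)^-1.
  by move=> Ax; rewrite -!beta_conj ?groupV // !invMg invgK !mulgA.
have betaG : beta \in G by rewrite genG mem_gen ?setU11.
have nAbeta : beta \notin A.
  apply: contra nonabG => Abeta; rewrite genG.
  by rewrite (setUidPr _) ?sub1set // genGid.
have GA g : g \in G -> g \notin A -> g * beta^-1 \in A.
  move=> Gg nAg; rewrite -mem_rcoset (rcoset_index2 sAG indexA) inE ?nAg //.
  by rewrite nAbeta.
have beta_mul y : y \in A -> beta * y = f y * beta.
  by move=> Ay; rewrite -beta_conj ?mulgKV.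
have betaV_mul y : y \in A -> beta^-1 * y = f y * beta^-1.
  by move=> Ay; rewrite -{1}[y]fK -beta_conj ?Af // !mulgA mulVg mul1g.
have betaV : beta^-1 = alpha^-1 * beta.
  by rewrite -beta2 expg2 invMg mulgKV.
set S := X :|: X :* beta.
have sSG : S \subset G.
  rewrite subUset (subset_trans sXA sAG) /=.
  by rewrite mul_subG ?sub1set // (subset_trans sXA sAG).
have XbA x : x \in A -> (x * beta \in A) = false.
  by move=> Ax; rewrite groupMl // (negPf nAbeta).
have XA x : x \notin A -> (x \in X) = false.
  by move=> nAx; apply/negP=> /(subsetP sXA); apply/negP.
have S_A g : g \in A -> (g \in S) = (g \in X).
  move=> Ag; rewrite inE mem_rcoset (XA (g * beta^-1)) ?orbF //.
  by rewrite groupMl // groupV.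
have S_Ab g : g \in A -> (g * beta \in S) = (g \in X).
  by move=> Ag; rewrite inE mem_rcoset mulgK (XA (g * beta)) ?XbA.
have S1 : 1 \notin S by rewrite S_A.
have XIXb : [disjoint X & X :* beta].
  rewrite -setI_eq0 -subset0; apply/subsetP=> z; rewrite inE mem_rcoset.
  case/andP=> /(subsetP sXA) Az /(subsetP sXA).
  by rewrite groupMl // groupV (negPf nAbeta).
have cS : #|S| = n.
  rewrite cardsU (disjoint_setI0 XIXb) cards0 card_rcoset subn0.
  by rewrite addnn -mul2n cX.
(* Split by whether the right factor s lies in X or in the disjoint set X beta. *)
have splitK g : (#|[set s in S | (g * s^-1)%g \in S]|
    = #|[set x in X | (g * x^-1)%g \in S]|
      + #|[set x in X | (g * (x * beta)^-1)%g \in S]|)%N.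
  rewrite -[X in (_ + X)%N](card_rcoset _ beta) -cardsUI.
  rewrite [_ :&: _](_ : _ = set0) ?cards0 ?addn0; last first.
    apply/eqP; rewrite -subset0 -(disjoint_setI0 XIXb); apply/subsetP=> z.
    by rewrite !inE !mem_rcoset !inE => /andP[/andP[-> _] /andP[-> _]].
  apply: eq_card => z; rewrite !inE !mem_rcoset !inE mulgKV.
  by rewrite mem_rcoset andb_orl.
clearbody S.
have fcount h : #|[set x in X | h * (f x)^-1 \in X]|
   = #|[set x in f @: X | h * x^-1 \in X]|.
  have mem_f z (Y : {set gT}) : (z \in f @: Y) = (f z \in Y).
    by rewrite -{1}[z]fK (mem_imset _ _ (@perm_inj _ f)).
  rewrite -(card_imset _ (@perm_inj _ f)); apply: eq_card => z.
  by rewrite mem_f !inE mem_f fK.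
have count g : g \in G ->
    #|[set s in S | g * s^-1 \in S]|
      = if g \in S then (n./2 - #|B|)%N else (n./2 + #|B|)%N.
  (* Both cosets of A reduce to this sum, with h the A-part of g. For h in X, [card_factorizations]
     forces |B| <= |X|, so the truncated subtraction is exact. *)
  have key h : h \in A -> (#|[set x in X | (h * x^-1)%g \in X]|
      + #|[set x in X | (h * (f x)^-1)%g \in X]|)%N
      = if h \in X then (n./2 - #|B|)%N else (n./2 + #|B|)%N.
    move=> Ah; rewrite fcount cX2.
    have := card_factorizations _ _ _ _ _ _ abA fA sXA defB XcosB aA XIfX XUaX _ Ah.
    by case: (h \in X) => /=; card_lia.
  move=> Gg; rewrite splitK; have [Ag|nAg] := boolP (g \in A).
    rewrite S_A // -key //; congr (_ + _)%N; apply: eq_card => x; rewrite !inE;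
      apply: andb_id2l => /(subsetP sXA) Ax.
      by rewrite S_A // groupM ?groupV.
    (* g (x beta)^-1 = g f(x)^-1 alpha^-1 beta, and X absorbs alpha^-1 because alpha is in B. *)
    rewrite invMg betaV_mul ?groupV // fV // betaV !mulgA S_Ab; last first.
      by rewrite !groupM ?groupV ?Af.
    by rewrite (union_of_cosets_mulr _ _ _ _ _ alpha^-1 XcosB) ?groupV.
  have [h Ah ->] : exists2 h, h \in A & g = h * beta.
    by exists (g * beta^-1); rewrite ?mulgKV ?GA.
  (* For g = h beta the two terms trade roles: g (x beta)^-1 = h x^-1, while g x^-1 = h f(x)^-1
     beta. *)
  rewrite S_Ab // -key // addnC; congr (_ + _)%N; apply: eq_card => x;
    rewrite !inE; apply: andb_id2l => /(subsetP sXA) Ax.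
    by rewrite invMg mulgA mulgK S_A // groupM ?groupV.
  rewrite -mulgA beta_mul ?groupV // fV // mulgA S_Ab //.
  by rewrite groupM ?groupV ?Af.
split=> [|x Gx|x Gx|x Gx|x y Gx Gy neq_xy] //.
- by rewrite /= mulgV.
- by rewrite card_Cay_out ?card_Cay_in.
- by rewrite card_Cay_between // count ?mulgV // (negPf S1).
- by rewrite card_Cay_between // count ?groupM ?groupV.
Qed.
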